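(* Let $K$ be a field, $S=K[t_1,\ldots,t_s]$, let $G$ be a graph with vertex set $\{t_1,\ldots,t_s\}$ without isolated vertices, and let $I_c(G)\subset S$ be the ideal of covers of $G$. The following conditions are equivalent: (i) $I_c(G)^{(2)}=I_c(G)^2$; (ii) $G$ is a bipartite graph.
   Context: Graphs are finite with no loops or multiple edges. A vertex cover of $G$ is a set of vertices meeting every edge; a minimal vertex cover is one minimal with respect to inclusion. The ideal of covers $I_c(G)$ is the ideal of $S$ generated by all $\prod_{t_i\in C}t_i$ with $C$ a minimal vertex cover of $G$. For an ideal $I\subset S$ and $n\geq 1$, the $n$-th symbolic power is $I^{(n)}:=\bigcap_{\mathfrak{p}\in\mathrm{minAss}(I)}(I^nS_{\mathfrak{p}}\cap S)$, where $\mathrm{minAss}(I)$ is the set of inclusion-minimal associated primes of $I$. *)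

(* Defs.v *)
From HB Require Import structures.
From mathcomp Require Import all_boot all_order all_algebra.
From mathcomp Require Import mpoly.

Set Implicit Arguments.
Unset Strict Implicit.
Unset Printing Implicit Defensive.

Import GRing.Theory.
Local Open Scope ring_scope.

(* Subsets of a ring are Prop-valued: the boolean predicates of ring_quotient
   are the decidable ideals only, and there ideals are moreover proper. *)
Section Ideals.
Variable R : comNzRingType.
Implicit Types (X I J p q : R -> Prop) (n : nat).

Definition subideal I J : Prop := forall f, I f -> J f.
Definition eqideal I J : Prop := forall f, I f <-> J f.

Definition is_ideal I : Prop :=
  [/\ I 0, forall f g, I f -> I g -> I (f + g)
    & forall a f, I f -> I (a * f)].

Definition is_prime_ideal p : Prop :=
  [/\ is_ideal p, ~ p 1 & forall f g, p (f * g) -> p f \/ p g].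

Definition ideal_gen X : R -> Prop := fun f =>
  exists r : seq (R * R),
    (forall c, c \in r -> X c.2) /\ f = \sum_(c <- r) c.1 * c.2.

Definition ideal_power I n : R -> Prop :=
  ideal_gen (fun f =>
    exists u : 'I_n -> R, (forall i, I (u i)) /\ f = \prod_i u i).

(* Associated primes of I in the sense of Ass(R/I): the primes (I : f). *)
Definition associated_prime I p : Prop :=
  is_prime_ideal p /\ exists f, forall g, p g <-> I (g * f).

Definition minimal_associated_prime I p : Prop :=
  associated_prime I p /\
  forall q, associated_prime I q -> subideal q p -> subideal p q.

End Ideals.

(* Localizations of a domain R are taken inside its fraction field. *)
Section SymbolicPower.
Variable R : idomainType.
Implicit Types (I J p : R -> Prop) (n : nat).

Local Notation "x %:F" := (@tofrac R x).

Definition localization p : {fraction R} -> Prop := fun u =>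
  exists a b : R, ~ p b /\ u = a%:F / b%:F.

(* J R_p, the ideal of R_p generated by the image of J. *)
Definition extension p J : {fraction R} -> Prop := fun u =>
  exists r : seq ({fraction R} * R),
    (forall c, c \in r -> localization p c.1 /\ J c.2) /\
    u = \sum_(c <- r) c.1 * c.2%:F.

(* J R_p \cap R *)
Definition ext_contraction p J : R -> Prop := fun f => extension p J f%:F.

(* The intersection is taken inside R, so it is R when I = R. *)
Definition symbolic_power I n : R -> Prop := fun f =>
  forall p, minimal_associated_prime I p ->
    ext_contraction p (ideal_power I n) f.

End SymbolicPower.

Section Graphs.
Variable (T : finType) (e : rel T).

Definition simple_graph : Prop := ssrbool.symmetric e /\ irreflexive e.

Definition no_isolated_vertex : Prop := forall x, exists y, e x y.

Definition vertex_cover (C : {set T}) : bool :=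
  [forall x, forall y, e x y ==> (x \in C) || (y \in C)].

Definition minimal_vertex_cover (C : {set T}) : bool := minset vertex_cover C.

(* A and its complement are the two parts of the bipartition. *)
Definition bipartite : Prop :=
  exists A : {set T}, forall x y, e x y -> (x \in A) != (y \in A).

End Graphs.

Definition cover_ideal (K : fieldType) (s : nat) (e : rel 'I_s) :
    {mpoly K[s]} -> Prop :=
  ideal_gen (fun f => exists C : {set 'I_s},
    minimal_vertex_cover e C /\ f = \prod_(i in C) 'X_i).
Arguments cover_ideal K {s} e.

(* Main.v *)
Require Import Defs.
From mathcomp Require Import all_boot all_order all_algebra.
From mathcomp Require Import mpoly.
From Stdlib Require Import Classical.

Set Implicit Arguments.
Unset Strict Implicit.
Unset Printing Implicit Defensive.

Import GRing.Theory.

(** Write I for the ideal of covers and p_xy for the ideal generated by the two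
    variables t_x and t_y.  All the ideals involved are monomial, that is, they
    consist of the polynomials all of whose monomials satisfy some condition
    closed under multiplication, and the theorem reduces to comparing two such
    conditions.

    - A monomial belongs to I^2 exactly when it is divisible by the product of
      two vertex covers ([cover_squareP]).
    - The minimal associated primes of I are exactly the ideals p_xy with xy an
      edge ([edge_minimal], [minimal_associated_edge]).  On the one hand p_xy is
      the colon ideal of I by the product of all variables other than t_x and
      t_y.  On the other hand a prime containing I contains both variables of
      some edge: otherwise the variables outside it would form a vertex cover,
      whose product lies in I.
    - A monomial with exponents m belongs to I^(2) exactly when
      m x + m y >= 2 for every edge xy ([symbolic_squareP]).  This condition
      is necessary because I^2 is contained in p_xy^2, which is p_xy-primary
      ([vanishing_primary]).  It is sufficient because, with w the product of the
      variables other than t_x and t_y, both w t_x and w t_y lie in I, while w is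
      invertible in the localization at p_xy.

    If the graph is bipartite, exponents with m x + m y >= 2 on every edge
    dominate two covers, chosen by splitting the vertices of exponent 1 along the
    bipartition ([bipartite_two_covers]).  Conversely the product of all the
    variables always lies in I^(2), and if it lies in I^2 then it is divisible by
    the product of two covers, which are therefore disjoint; an edge meets both
    of them, so has exactly one end in the first ([two_covers_bipartite]). *)

(** * Ideals given by generators, and primes *)

Section Ideals.
Local Open Scope ring_scope.
Variable R : comNzRingType.
Implicit Types (I J p : R -> Prop).

Lemma ideal_sum (A : eqType) I (r : seq A) (F : A -> R) : is_ideal I ->
  (forall a, a \in r -> I (F a)) -> I (\sum_(a <- r) F a).
Proof.
move=> [I0 ID _] IF; rewrite big_seq.
by elim/big_rec: _ => // a f /IF; apply: ID.
Qed.

Lemma ideal_gen_is_ideal (X : R -> Prop) : is_ideal (ideal_gen X).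
Proof.
split=> [|f g [r [Xr ->]] [r' [Xr' ->]]|a f [r [Xr ->]]].
- by exists [::]; rewrite big_nil.
- exists (r ++ r'); rewrite big_cat; split=> // c.
  by rewrite mem_cat => /orP[/Xr|/Xr'].
- exists [seq (a * c.1, c.2) | c <- r]; split.
    by move=> _ /mapP[c /Xr Xc ->].
  by rewrite big_map mulr_sumr; apply: eq_bigr => c _; rewrite mulrA.
Qed.

Lemma sub_ideal_gen (X : R -> Prop) f : X f -> ideal_gen X f.
Proof.
move=> Xf; exists [:: (1, f)]; rewrite big_seq1 mul1r; split=> // c.
by rewrite inE => /eqP->.
Qed.

Lemma ideal_gen_min (X : R -> Prop) J :
  is_ideal J -> (forall f, X f -> J f) -> subideal (ideal_gen X) J.
Proof.
move=> idJ XJ _ [r [Xr ->]]; apply: ideal_sum => // c /Xr/XJ.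
by case: idJ => _ _; apply.
Qed.

Lemma ideal_square_mul I f g : I f -> I g -> ideal_power I 2 (f * g).
Proof.
move=> If Ig; apply: sub_ideal_gen.
exists (fun i : 'I_2 => if i == ord0 then f else g); split.
  by move=> i; case: ifP.
by rewrite big_ord_recl big_ord1.
Qed.

Lemma ideal_square_min I J : is_ideal J ->
  (forall f g, I f -> I g -> J (f * g)) -> subideal (ideal_power I 2) J.
Proof.
move=> idJ IJ; apply: ideal_gen_min => // _ [u [Iu ->]].
by rewrite big_ord_recl big_ord1; apply: IJ.
Qed.

Lemma associated_sub I p :
  is_ideal I -> associated_prime I p -> subideal I p.
Proof. by move=> [_ _ IM] [_ [h pE]] f If; apply/pE; rewrite mulrC; apply: IM. Qed.

Lemma prime_prod (A : finType) p (P : pred A) (F : A -> R) : is_prime_ideal p ->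
  p (\prod_(a | P a) F a) -> exists2 a, P a & p (F a).
Proof.
move=> [_ p1 pM]; elim/big_rec: _ => [/p1 // | a f Pa IH /pM[pa|/IH //]].
by exists a.
Qed.

End Ideals.

(** * Contracting ideals from a localization *)

Section Contraction.
Local Open Scope ring_scope.
Variable R : idomainType.
Implicit Types (J p : R -> Prop) (f : R).
Local Notation "x %:F" := (@tofrac R x).

(** A common denominator exists outside p, because p is prime. *)
Lemma extension_fraction p J u : is_prime_ideal p -> is_ideal J ->
  extension p J u -> exists a b, [/\ J a, ~ p b & u = a%:F / b%:F].
Proof.
move=> [[p0 _ _] p1 pM] [J0 JD JM] [r [pJr ->]].
have nz b : ~ p b -> b%:F != 0.
  by move=> pb; rewrite tofrac_eq0; apply/eqP => b0; apply: pb; rewrite b0.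
rewrite big_seq; elim/big_rec: _ => [|c v /pJr[[a [b [pb ->]]] Jc]].
  by exists 0, 1; rewrite tofrac0 mul0r.
move=> [a' [b' [Ja' pb' ->]]]; exists (b' * (a * c.2) + b * a'), (b * b').
split; [by apply: (JD); do ?apply: (JM) | by case/pM |].
rewrite tofracD !tofracM mulrAC addf_div ?nz //.
by congr ((_ + _) / _); rewrite mulrC.
Qed.

(** The contraction of the extension of J is the saturation of J by the
    complement of p, which removes the fraction field from the rest of the
    argument. *)
Lemma ext_contractionP p J f : is_prime_ideal p -> is_ideal J ->
  ext_contraction p J f <-> exists2 b, ~ p b & J (b * f).
Proof.
move=> pr_p idJ; split=> [|[b pb Jbf]].
  move=> /(extension_fraction pr_p idJ)[a [b [Ja pb Ef]]].
  exists b => //; suff -> : b * f = a by [].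
  apply/eqP; rewrite -tofrac_eq tofracM Ef mulrC divfK // tofrac_eq0.
  by apply/eqP => b0; apply: pb; rewrite b0; case: pr_p => -[].
exists [:: (1%:F / b%:F, b * f)]; split.
  by move=> c; rewrite inE => /eqP->; split=> //; exists 1, b.
rewrite big_seq1 tofrac1 mul1r tofracM mulKf // tofrac_eq0.
by apply/eqP => b0; apply: pb; rewrite b0; case: pr_p => -[].
Qed.

End Contraction.

(** * Monomial ideals and vanishing along coordinate subspaces *)

(** The lowest nonzero coefficient of q, multiplied by the constant coefficient
    of p, would survive in p q. *)
Lemma low_coefs0 (D : idomainType) (p q : {poly D}) k : (p`_0 != 0)%R ->
    (forall d, d < k -> ((p * q)`_d = 0)%R) ->
  forall d, d < k -> (q`_d = 0)%R.
Proof.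
move=> p0 pq0 d; elim/ltn_ind: d => d IH ltdk.
have := pq0 d ltdk; rewrite coefM big_ord_recl big1 => [|i _].
  by rewrite addr0 subn0 => /eqP; rewrite mulf_eq0 (negPf p0) => /eqP.
have lt_d : d - lift ord0 i < d.
  by rewrite lift0 ltn_subrL /= (leq_ltn_trans _ (ltn_ord i)).
by rewrite (IH _ lt_d (ltn_trans lt_d ltdk)) mulr0.
Qed.

Section Monomials.
Local Open Scope ring_scope.
Variables (K : fieldType) (s : nat).
Implicit Types (f g : {mpoly K[s]}) (m : 'X_{1..s}) (P C : {set 'I_s}).
Implicit Types (Q : 'X_{1..s} -> Prop) (J : {mpoly K[s]} -> Prop).

(** When Q is closed under multiplication by monomials, this is the monomial
    ideal whose monomials are those satisfying Q. *)
Definition supported Q f := forall m, m \in msupp f -> Q m.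

Lemma supported_is_ideal Q :
  (forall m m', Q m -> Q (m' + m)%MM) -> is_ideal (supported Q).
Proof.
move=> upQ; split=> [m|f g Qf Qg m|a f Qf m]; first by rewrite msupp0.
- by move/msuppD_le; rewrite mem_cat => /orP[/Qf|/Qg].
- by move/msuppM_le => /allpairsP[[m1 m2] /= [_ /Qf Qm2 ->]]; apply: upQ.
Qed.

Lemma supported_min Q J : is_ideal J ->
  (forall m, Q m -> J 'X_[m]) -> subideal (supported Q) J.
Proof.
move=> idJ QJ f Qf; rewrite (mpolyE f); apply: ideal_sum => // m /Qf/QJ.
by rewrite -mul_mpolyC; case: idJ => _ _; apply.
Qed.

Lemma supportedX Q m : supported Q 'X_[m] <-> Q m.
Proof.
split=> [|Qm m']; first by apply; rewrite msuppX inE.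
by rewrite msuppX inE => /eqP->.
Qed.

Definition weight P m : nat := \sum_(i in P) m i.

(** This is the k-th power of the ideal generated by the variables in P; for
    k = 1 it is that prime ideal itself. *)
Definition vanishing P k : {mpoly K[s]} -> Prop :=
  supported (fun m => k <= weight P m)%N.

Lemma weightD P m m' : weight P (m + m')%MM = (weight P m + weight P m')%N.
Proof. by rewrite /weight -big_split; apply: eq_bigr => i _; rewrite mnmDE. Qed.

Lemma weight_set2 (x y : 'I_s) m :
  x != y -> weight [set x; y] m = (m x + m y)%N.
Proof. by move=> neq_xy; rewrite /weight big_setU1 ?big_set1 ?inE. Qed.

(** The substitution of t_i 'X for t_i when i is in P records the degree in the
    variables of P as a degree in 'X.  Being a ring morphism, it turns questions
    on products of multivariate polynomials into questions on coefficients of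
    products of univariate polynomials. *)
Definition grading P : {mpoly K[s]} -> {poly {mpoly K[s]}} :=
  mmap (polyC \o @mpolyC s K) (fun i => ('X_i)%:P * 'X^(i \in P)).

Lemma gradingM P : {morph grading P : f g / f * g}.
Proof. by move=> f g; rewrite /grading rmorphM. Qed.

Lemma coef_grading P f d m :
  ((grading P f)`_d)@_m = f@_m *+ (weight P m == d).
Proof.
have mono m' : mmap1 (fun i => ('X_i)%:P * 'X^(i \in P)) m'
    = ('X_[m'])%:P * 'X^(weight P m') :> {poly {mpoly K[s]}}.
  rewrite /mmap1 /weight mpolyXE_id rmorph_prod.
  rewrite [in RHS](big_mkcond (mem P)) expr_sum -big_split.
  apply: eq_bigr => i _ /=; rewrite exprMn rmorphXn -exprM.
  by case: (i \in P); rewrite ?mul1n ?mul0n.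
rewrite /grading /mmap coef_sum raddf_sum /=.
under eq_bigr => m' _ do
  rewrite mono mulrA -polyCM coefCM coefXn mul_mpolyC mulr_natr mcoeffMn mcoeffZ
    mcoeffX.
have [m_f | m_f] := boolP (m \in msupp f).
  rewrite (bigD1_seq m) ?msupp_uniq //= eqxx mulr1 eq_sym big1 ?addr0 //.
  by move=> m' /negPf->; rewrite mulr0 mul0rn.
rewrite (memN_msupp_eq0 m_f) mul0rn big_seq big1 // => m' m'_f.
by case: eqP m_f => [<-|_ _]; rewrite ?m'_f // mulr0 mul0rn.
Qed.

Lemma vanishingP P k f :
  vanishing P k f <-> forall d, (d < k)%N -> (grading P f)`_d = 0.
Proof.
split=> [kf d ltdk | f0 m].
  apply/mpolyP => m; rewrite coef_grading mcoeff0.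
  have [/kf km|/memN_msupp_eq0->] := boolP (m \in msupp f); last exact: mul0rn.
  by rewrite gtn_eqF // (leq_trans ltdk).
rewrite mcoeff_msupp leqNgt; apply: contraNN => /f0/mpolyP/(_ m).
by rewrite coef_grading eqxx mcoeff0 mulr1n => ->.
Qed.

Lemma vanishing_is_ideal P k : is_ideal (vanishing P k).
Proof.
apply: supported_is_ideal => m m' km.
by rewrite weightD (leq_trans km) ?leq_addl.
Qed.

(** Powers of a prime generated by variables are primary: if b lies outside the
    prime, its image under the grading has a nonzero constant coefficient, and
    such a factor cannot raise the order at 'X = 0. *)
Lemma vanishing_primary P k f b :
  ~ vanishing P 1 b -> vanishing P k (b * f) -> vanishing P k f.
Proof.
move=> b0 /vanishingP; rewrite gradingM => bf0.
have {}b0 : (grading P b)`_0 != 0.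
  apply/eqP => b00; apply/b0/vanishingP => d.
  by rewrite ltnS leqn0 => /eqP->.
by apply/vanishingP; apply: low_coefs0 b0 bf0.
Qed.

Lemma vanishing_prime P : is_prime_ideal (vanishing P 1).
Proof.
split=> [||f g fg]; first exact: vanishing_is_ideal.
  rewrite -mpolyX0 => /supportedX; rewrite /weight.
  by rewrite big1 // => i _; rewrite mnm0E.
have [?|f0] := classic (vanishing P 1 f); first by left.
by right; apply: vanishing_primary f0 fg.
Qed.

Lemma mem_ideal_lem J m m' : is_ideal J -> (m <= m')%MM ->
  J 'X_[m] -> J 'X_[m'].
Proof.
by move=> [_ _ JM] /submK <- Jm; rewrite mpolyXD; apply: JM.
Qed.

Lemma vanishing_subideal P J :
  is_ideal J -> (forall i, i \in P -> J 'X_i) -> subideal (vanishing P 1) J.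
Proof.
move=> idJ JP; apply: supported_min => // m.
rewrite lt0n sum_nat_eq0 => /forallPn[i]; rewrite negb_imply -lep1mP.
by case/andP=> /JP Ji /mem_ideal_lem; apply.
Qed.

Lemma prod_mesym1 C : \prod_(i in C) 'X_i = 'X_[mesym1 C] :> {mpoly K[s]}.
Proof.
rewrite mpolyXE_id big_mkcond; apply: eq_bigr => i _.
by rewrite mnmE; case: (i \in C).
Qed.

Lemma weight_mesym1 P C : weight P (mesym1 C) = #|P :&: C|.
Proof.
rewrite -sum1_card big_mkcond [RHS]big_mkcond /weight [LHS]big_mkcond /=.
by apply: eq_bigr => i _; rewrite inE mnmE; case: (i \in P); case: (i \in C).
Qed.

Lemma vanishingX P (i : 'I_s) : vanishing P 1 'X_i <-> i \in P.
Proof.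
rewrite -mesym1_set1; split=> [/supportedX|Pi]; last apply/supportedX.
  by rewrite weight_mesym1 => /card_gt0P[j]; rewrite !inE => /andP[? /eqP<-].
by rewrite weight_mesym1; apply/card_gt0P; exists i; rewrite !inE Pi /=.
Qed.

End Monomials.

(** * The ideal of covers and its square *)

Section CoverIdeal.
Local Open Scope ring_scope.
Variables (K : fieldType) (s : nat) (e : rel 'I_s).
Hypothesis simple_e : simple_graph e.
Implicit Types (f g : {mpoly K[s]}) (m : 'X_{1..s}) (C D : {set 'I_s}).
Implicit Types (x y z : 'I_s) (p q : {mpoly K[s]} -> Prop).

Local Notation Ic := (cover_ideal K e).

Lemma edge_neq x y : e x y -> x != y.
Proof.
by case: simple_e => _ irr; apply: contraTneq => ->; rewrite irr.
Qed.

Lemma vertex_coverP C :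
  reflect (forall x y, e x y -> (x \in C) || (y \in C)) (vertex_cover e C).
Proof.
apply: (iffP forallP) => [coverC x y exy | coverC x].
  by have /forallP/(_ y) := coverC x; rewrite exy.
by apply/forallP => y; apply/implyP; apply: coverC.
Qed.

(** An edge missing the complement of x would be a loop at x. *)
Lemma vertex_coverC1 x : vertex_cover e (~: [set x]).
Proof.
apply/vertex_coverP => y z /edge_neq neq_yz; rewrite !inE -negb_and.
by apply: contra neq_yz => /andP[/eqP-> /eqP->].
Qed.

Definition above_cover m :=
  exists2 C, vertex_cover e C & (mesym1 C <= m)%MM.

Definition above_two_covers m := exists C D,
  [/\ vertex_cover e C, vertex_cover e D & (mesym1 C + mesym1 D <= m)%MM].

Lemma cover_ideal_is_ideal : is_ideal Ic.
Proof. exact: ideal_gen_is_ideal. Qed.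

Lemma lem_addlW m m' m0 : (m0 <= m)%MM -> (m0 <= m' + m)%MM.
Proof. by move/lepm_trans; apply; apply: lem_addl. Qed.

(** Every cover contains a minimal one, so the product over an arbitrary cover is
    a multiple of a generator. *)
Lemma cover_idealP f : Ic f <-> supported above_cover f.
Proof.
split; move: f.
  apply: ideal_gen_min => [|_ [C [/minsetp coverC ->]]].
    apply: supported_is_ideal => m m' [C coverC leCm].
    by exists C; last exact: lem_addlW.
  by rewrite prod_mesym1; apply/supportedX; exists C; rewrite ?lepm_refl.
apply: supported_min cover_ideal_is_ideal _ => m [C coverC leCm].
apply: mem_ideal_lem leCm _; first exact: cover_ideal_is_ideal.
have [D minD subDC] := minset_exists coverC.
apply: (@mem_ideal_lem _ _ _ (mesym1 D) _ cover_ideal_is_ideal).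
  apply/mnm_lepP => i; rewrite !mnmE; case: (boolP (i \in D)) => //.
  by move/(subsetP subDC)->.
by apply: sub_ideal_gen; exists D; rewrite prod_mesym1.
Qed.

Lemma cover_ideal_prod C : vertex_cover e C -> Ic 'X_[mesym1 C].
Proof.
by move=> coverC; apply/cover_idealP/supportedX; exists C; rewrite ?lepm_refl.
Qed.

Lemma cover_squareP f :
  ideal_power Ic 2 f <-> supported above_two_covers f.
Proof.
have id2 : is_ideal (ideal_power Ic 2) by apply: ideal_gen_is_ideal.
split; move: f.
  apply: ideal_square_min => [|f g /cover_idealP supp_f /cover_idealP supp_g m].
    apply: supported_is_ideal => m m' [C [D [coverC coverD leCDm]]].
    by exists C, D; split=> //; apply: lem_addlW.
  move=> /msuppM_le/allpairsP[[m1 m2] /= [/supp_f[C covC leC]]].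
  move=> /supp_g[D covD leD] ->; exists C, D; split=> //.
  by apply/mnm_lepP => i; rewrite !mnmDE leq_add //; apply/mnm_lepP.
apply: supported_min => // m [C [D [coverC coverD leCDm]]].
apply: mem_ideal_lem leCDm _ => //; rewrite mpolyXD.
by apply: ideal_square_mul; apply/cover_idealP/supportedX;
  [exists C | exists D]; rewrite ?lepm_refl.
Qed.

(** * Minimal primes and the symbolic square *)

Lemma weight_cover x y C :
  e x y -> vertex_cover e C -> (0 < weight [set x; y] (mesym1 C))%N.
Proof.
move=> exy /vertex_coverP/(_ _ _ exy) xyC; rewrite weight_mesym1.
by apply/card_gt0P; case/orP: xyC; [exists x | exists y]; rewrite !inE eqxx ?orbT.
Qed.

Lemma weight_le P m m' : (m <= m')%MM -> (weight P m <= weight P m')%N.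
Proof. by move/mnm_lepP => lemm'; apply: leq_sum. Qed.

Lemma cover_ideal_vanishing x y :
  e x y -> subideal Ic (vanishing [set x; y] 1).
Proof.
move=> exy f /cover_idealP supp_f m /supp_f[C covC leC].
exact: leq_trans (weight_cover exy covC) (weight_le _ leC).
Qed.

(** The prime is the colon ideal of I by the product w of the variables other
    than t_x and t_y.  Indeed w t_x is the product over the complement of y, which
    is a cover, and symmetrically for w t_y; conversely I is contained in the
    prime, and w is not in it. *)
Lemma edge_associated x y :
  e x y -> associated_prime Ic (vanishing [set x; y] 1).
Proof.
move=> exy; split; first exact: vanishing_prime.
exists 'X_[mesym1 (~: [set x; y])] => g; split; move: g.
  apply: vanishing_subideal => [|i xy_i].
    have [I0 ID IM] := cover_ideal_is_ideal.
    split=> [|f g If Ig|a f If]; rewrite ?mul0r ?mulrDl -?mulrA //.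
      exact: ID.
    exact: IM.
  apply/cover_idealP; rewrite -mpolyXD; apply/supportedX.
  have neq_xy := edge_neq exy.
  case/set2P: xy_i => ->; [exists (~: [set y]) | exists (~: [set x])];
    rewrite ?vertex_coverC1 //; apply/mnm_lepP => j; rewrite mnmDE !mnmE !inE.
  - by rewrite [x == j]eq_sym; case: (j == x); case: (j == y).
  - by rewrite [y == j]eq_sym; case: (j == x); case: (j == y).
move=> g Igh; have [_ _ pM] := vanishing_prime K [set x; y].
case: (pM _ _ (cover_ideal_vanishing exy Igh)) => // /supportedX.
by rewrite weight_mesym1 setICr cards0.
Qed.

(** If no edge had both its variables in p, the variables outside p would form
    a vertex cover, and the product over this cover would lie in I, hence in p. *)
Lemma prime_above_cover_ideal p : is_prime_ideal p -> subideal Ic p ->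
  exists x y, [/\ e x y, p 'X_x & p 'X_y].
Proof.
move=> pr_p sIp.
have /fin_all_exists[b bP] x : exists b : bool, p 'X_x <-> ~~ b.
  by have [px|px] := classic (p 'X_x); [exists false | exists true]; split.
have [/cover_ideal_prod/sIp | ] := boolP (vertex_cover e [set x | b x]).
  by rewrite -prod_mesym1 => /(prime_prod pr_p)[x]; rewrite inE => bx /bP/negP.
case/forallPn => x /forallPn[y]; rewrite negb_imply negb_or !inE.
by case/and3P => exy /bP px /bP py; exists x, y.
Qed.

(** A smaller associated prime still contains the two variables of some edge;
    these lie in the ideal of x and y, so the edge is the same one. *)
Lemma edge_minimal x y : e x y ->
  minimal_associated_prime Ic (vanishing [set x; y] 1).
Proof.
move=> exy; split; first exact: edge_associated.
move=> q ass_q sub_q; have [pr_q _] := ass_q; have [id_q _ _] := pr_q.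
have [u [v [/edge_neq neq_uv qu qv]]] :=
  prime_above_cover_ideal pr_q (associated_sub cover_ideal_is_ideal ass_q).
have /sub_q/vanishingX Pu := qu; have /sub_q/vanishingX Pv := qv.
have -> : [set x; y] = [set u; v].
  apply/esym/eqP; rewrite eqEcard subUset !sub1set Pu Pv !cards2 neq_uv.
  by case: (x != y).
by apply: vanishing_subideal => // i /set2P[]->.
Qed.

Lemma minimal_associated_edge p : minimal_associated_prime Ic p ->
  exists x y, e x y /\ eqideal p (vanishing [set x; y] 1).
Proof.
move=> [ass_p min_p]; have [pr_p _] := ass_p; have [id_p _ _] := pr_p.
have [x [y [exy px py]]] :=
  prime_above_cover_ideal pr_p (associated_sub cover_ideal_is_ideal ass_p).
have sub_p : subideal (vanishing [set x; y] 1) p.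
  by apply: vanishing_subideal => // i /set2P[]->.
exists x, y; split=> // f; split; last exact: sub_p.
exact: min_p (edge_associated exy) sub_p f.
Qed.

Lemma above_two_covers_edge m :
  above_two_covers m -> forall x y, e x y -> (2 <= m x + m y)%N.
Proof.
move=> [C [D [coverC coverD leCDm]]] x y exy.
rewrite -weight_set2 ?edge_neq //; apply: leq_trans (weight_le _ leCDm).
by rewrite weightD -addn1 leq_add ?weight_cover.
Qed.

(** Localizing at an edge xy keeps only the condition on that edge: the order of
    vanishing cannot be raised by a denominator outside the prime, and the
    denominator w^2, with w the product of the variables other than t_x and t_y,
    clears all the other conditions. *)
Lemma symbolic_squareP f : symbolic_power Ic 2 f <->
  supported (fun m => forall x y, e x y -> 2 <= m x + m y)%N f.
Proof.
have id2 : is_ideal (ideal_power Ic 2) by apply: ideal_gen_is_ideal.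
split=> [symb_f m m_f x y exy | edge_f p].
  have [ass_p _] := edge_minimal exy; have [pr_p _] := ass_p.
  have /(ext_contractionP _ pr_p id2)[b pb /cover_squareP bf2] :=
    symb_f _ (edge_minimal exy).
  rewrite -weight_set2 ?edge_neq //; move: m m_f.
  apply: vanishing_primary pb _ => m /bf2.
  by rewrite weight_set2 ?edge_neq // => /above_two_covers_edge; apply.
move=> min_p; have [[pr_p _] _] := min_p.
have [x [y [exy pE]]] := minimal_associated_edge min_p.
apply/ext_contractionP => //.
pose w : 'X_{1..s} := mesym1 (~: [set x; y]).
have pw : ~ p 'X_[w] by move/pE/supportedX; rewrite weight_mesym1 setICr cards0.
exists ('X_[w] * 'X_[w]); first by case: pr_p => _ _ pM /pM[].
apply/cover_squareP; rewrite -mpolyXD => m /msuppM_le.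
rewrite msuppX => /allpairsP[[_ m'] /=
  [/[!inE]/eqP-> /edge_f/(_ _ _ exy) m'2 ->]].
have neq_xy := edge_neq exy.
have w_j j : w j = (j != x) && (j != y) by rewrite mnmE !inE negb_or.
have C_j z j : mesym1 (~: [set z]) j = (j != z) by rewrite mnmE !inE.
(* The monomial m' is divisible by t_x^2, by t_y^2 or by t_x t_y, and the products
   over the complements of y and of x are w t_x and w t_y. *)
have [m'x | m'x] := leqP 2 (m' x).
  exists (~: [set y]), (~: [set y]); rewrite !vertex_coverC1; split=> //.
  apply/mnm_lepP => j; rewrite !mnmDE !w_j !C_j.
  have [->|_] := eqVneq j x; last by case: (j == y).
  by rewrite neq_xy (leq_trans m'x) ?leq_addl.
have [m'y | m'y] := leqP 2 (m' y).
  exists (~: [set x]), (~: [set x]); rewrite !vertex_coverC1; split=> //.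
  apply/mnm_lepP => j; rewrite !mnmDE !w_j !C_j.
  have [->|_] := eqVneq j y; last by case: (j == x).
  by rewrite eq_sym neq_xy (leq_trans m'y) ?leq_addl.
have [m'x1 m'y1] : m' x = 1%N /\ m' y = 1%N.
  by case: (m' x) (m' y) m'x m'y m'2 => [|[|?]] [|[|?]].
exists (~: [set x]), (~: [set y]); rewrite !vertex_coverC1; split=> //.
apply/mnm_lepP => j; rewrite !mnmDE !w_j !C_j.
have [->|_] := eqVneq j x; first by rewrite m'x1 neq_xy.
by have [->|_] := eqVneq j y; rewrite ?m'y1 ?leq_addr.
Qed.

(** * Bipartiteness as a splitting property of covers *)

(** A vertex of exponent at least 2 goes into both covers, and a vertex of
    exponent 1 into the cover named after its side of the bipartition: an edge
    whose exponents are both 1 has one end on each side, so it meets both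
    covers.  If one exponent is 0, the other is at least 2. *)
Lemma bipartite_two_covers m : bipartite e ->
  (forall x y, e x y -> 2 <= m x + m y)%N -> above_two_covers m.
Proof.
move=> [A bipA] edge_m.
pose B c i := ((1 < m i) || ((i \in A) == c) && (0 < m i))%N.
have coverB c : vertex_cover e [set i | B c i].
  apply/vertex_coverP => x y exy; move: (edge_m _ _ exy) (bipA _ _ exy).
  rewrite !inE /B.
  by case: c (x \in A) (y \in A) (m x) (m y) => [] [] [] [|[|?]] [|[|?]].
exists [set i | B true i], [set i | B false i]; split=> //.
apply/mnm_lepP => i; rewrite mnmDE !mnmE !inE /B.
by case: (i \in A) (m i) => [] [|[|?]].
Qed.

(** Two covers whose product is squarefree are disjoint, and the first one is
    then a side of a bipartition. *)
Lemma two_covers_bipartite :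
  above_two_covers (mesym1 [set: 'I_s]) -> bipartite e.
Proof.
move=> [C [D [/vertex_coverP covC /vertex_coverP covD /mnm_lepP disjCD]]].
have {}disjCD i : ~~ ((i \in C) && (i \in D)).
  by have := disjCD i; rewrite mnmDE !mnmE inE; case: (i \in C) (i \in D) => [] [].
exists C => x y exy; move: (covC _ _ exy) (covD _ _ exy) (disjCD x) (disjCD y).
by case: (x \in C) (y \in C) (x \in D) (y \in D) => [] [] [] [].
Qed.

End CoverIdeal.

Theorem proposition6p2 (K : fieldType) (s : nat) (e : rel 'I_s)
    (simple_e : simple_graph e) (no_isolated_e : no_isolated_vertex e) :
  eqideal (symbolic_power (cover_ideal K e) 2) (ideal_power (cover_ideal K e) 2)
  <-> bipartite e.
Proof.
split=> [eq2 | bip f].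
  (* The witness is the product of all the variables. *)
  apply/two_covers_bipartite/(supportedX K).
  apply/cover_squareP/eq2/(symbolic_squareP simple_e)/supportedX.
  by move=> x y _; rewrite !mnmE !inE.
split=> [/(symbolic_squareP simple_e) edge_f | /cover_squareP supp_f].
  by apply/cover_squareP => m /edge_f; apply: bipartite_two_covers.
by apply/(symbolic_squareP simple_e) => m /supp_f/(above_two_covers_edge simple_e).
Qed.
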